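(* Let $0\le c<1$ and let $\ell_{\mathrm{cDPO}}(s,\theta)=(1-c)\big(-\log\sigma(g_\theta(s))\big)-c\big(-\log\sigma(-g_\theta(s))\big)$ be the cDPO per-sample loss. Let $\theta^*\in\arg\min_\theta\mathbb{E}_{p_{\mathcal D}}[\ell_{\mathrm{cDPO}}(s,\theta)]$ and $\theta^*(\epsilon)\in\arg\min_\theta\mathbb{E}_{p^{(\epsilon)}}[\ell_{\mathrm{cDPO}}(\tilde s,\theta)]$. Assume that the Hessian $\nabla^2_\theta\ell_{\mathrm{cDPO}}(s,\theta)|_{\theta=\theta^*}$ is positive definite (for $p_{\mathcal D}$-almost every $s$). Suppose that the policy gradient $\nabla_\theta\log\pi_\theta(y\mid x)$ is bounded in norm by $C$ and is $L$-Lipschitz in $\theta$, where $0<C<\infty$ and $0<L<\infty$. Then the influence function of cDPO does not satisfy the redescending property, i.e. $$\lim_{\hat r_{\theta^*}(x,y^{\mathrm{flip}}_{\mathrm{lose}})\to\infty}\|\mathrm{IF}_{\mathrm{cDPO}}(x,\theta,p_{\mathcal D})\|\neq 0 .$$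
   Context: Parameters $\theta$ range over an open set $\Theta\subseteq\mathbb{R}^d$; $\pi_\theta(y\mid x)>0$ is a parametric policy, $\pi_{\mathrm{ref}}(y\mid x)>0$ a fixed reference policy. A preference data point is $s=(x,y_{\mathrm{win}},y_{\mathrm{lose}})$. For $\beta>0$, $\hat r_\theta(x,y)=\beta\log\frac{\pi_\theta(y\mid x)}{\pi_{\mathrm{ref}}(y\mid x)}$ and $g_\theta(s)=\hat r_\theta(x,y_{\mathrm{win}})-\hat r_\theta(x,y_{\mathrm{lose}})$; $\sigma(a)=1/(1+e^{-a})$. Contamination model: $p_{\mathcal D}$ is the distribution of clean points $s$; $p_{\mathrm{flip}}$ is the distribution of flipped points $s_{\mathrm{flip}}=(x,y^{\mathrm{flip}}_{\mathrm{win}},y^{\mathrm{flip}}_{\mathrm{lose}})$ (with $y^{\mathrm{flip}}_{\mathrm{win}}=y_{\mathrm{lose}}$, $y^{\mathrm{flip}}_{\mathrm{lose}}=y_{\mathrm{win}}$); for $0\le\epsilon<1/2$, $p^{(\epsilon)}=(1-\epsilon)p_{\mathcal D}+\epsilon\,p_{\mathrm{flip}}$, and $\tilde s\sim p^{(\epsilon)}$. Influence function: $\mathrm{IF}_{\mathrm{cDPO}}(x,\theta,p_{\mathcal D}):=\frac{\partial\theta^*(\epsilon)}{\partial\epsilon}\big|_{\epsilon=0}$, with $\theta^*(0)=\theta^*$; it is implicit that this derivative exists, that $g_\theta$ is smooth in $\theta$, that first-order optimality conditions hold, and that expectations may be differentiated under the integral sign. Redescending property: $\lim_{\hat r_\theta(x,y^{\mathrm{flip}}_{\mathrm{lose}})\to\infty}\|\mathrm{IF}\|=0$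 (Euclidean norm). The limit is the worst-case regime in which the flipped data vary, with $p_{\mathcal D}$ and $\theta^*$ fixed, so that $\hat r_{\theta^*}(x,y^{\mathrm{flip}}_{\mathrm{lose}})\to\infty$ and $g_{\theta^*}(s_{\mathrm{flip}})\to-\infty$ (uniformly over the support of $p_{\mathrm{flip}}$).
   Formalization: Added assumption: the mean of the gradient of g at θ* over the flipped data does not itself tend to 0 in the limiting regime; without it the claim fails (e.g. flipped points whose policy does not depend on θ give IF = 0). ''lim ≠ 0'' is read as ''the norm of IF does not tend to 0''. *)

(* Defs.v *)
From HB Require Import structures.
From mathcomp Require Import all_boot all_order all_algebra.
From mathcomp Require Import all_classical all_reals all_analysis.

Set Implicit Arguments.
Unset Strict Implicit.
Unset Printing Implicit Defensive.

Import Order.TTheory GRing.Theory Num.Theory.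
Import numFieldNormedType.Exports.

Local Open Scope classical_set_scope.
Local Open Scope ring_scope.

Section calculus.
Context {R : realType} {d : nat}.
Implicit Types (f : 'rV[R]_d -> R) (t v : 'rV[R]_d).

(* The library norm `|v| on 'rV[R]_d is the sup norm. *)
Definition enorm v : R := Num.sqrt (\sum_(i < d) v 0 i ^+ 2).

Definition grad f t : 'rV[R]_d := \row_i 'D_(delta_mx 0 i) f t.

(* Entry (i, j) is the i-th partial derivative of the j-th partial of f. *)
Definition hessian f t : 'M[R]_d := 'J (grad f) t.

Definition C2_on (Theta : set 'rV[R]_d) f :=
  forall t, Theta t ->
    [/\ differentiable f t, differentiable (grad f) t
      & {for t, continuous (hessian f)}].

Definition posdefmx (A : 'M[R]_d) :=
  A^T = A /\ forall v, v != 0 -> 0 < (v *m A *m v^T) 0 0.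

Definition is_argmin (Theta : set 'rV[R]_d) f t :=
  Theta t /\ forall t', Theta t' -> f t <= f t'.

(* The curve is only meaningful for nonnegative contamination levels, so its
   derivative at 0 is the right derivative. *)
Definition influence_quotient (th : R -> 'rV[R]_d) : R -> 'rV[R]_d :=
  fun eps => eps^-1 *: (th eps - th 0).

Definition has_influence (th : R -> 'rV[R]_d) : Prop :=
  cvg (influence_quotient th eps @[eps --> 0^'+]).

Definition influence (th : R -> 'rV[R]_d) : 'rV[R]_d :=
  lim (influence_quotient th eps @[eps --> 0^'+]).

End calculus.

Section preferences.
Context {R : realType} {dX dY : measure_display}.
Context {X : measurableType dX} {Y : measurableType dY}.

(* A policy x |-> p x is a positive conditional density with respect to a base
   measure nu on responses (the counting measure for discrete responses). *)
Definition is_policy (nu : {measure set Y -> \bar R}) (p : X -> Y -> R) :=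
  [/\ forall x y, 0 < p x y,
      measurable_fun [set: X * Y] (fun xy => p xy.1 xy.2)
    & forall x, (\int[nu]_y (p x y)%:E = 1)%E].

(* A preference point is s = (x, (y_win, y_lose)). *)
Definition flip (s : X * (Y * Y)) : X * (Y * Y) := (s.1, (s.2.2, s.2.1)).

Lemma measurable_flip : measurable_fun [set: X * (Y * Y)] flip.
Proof.
apply: measurable_fun_pair; first exact: measurable_fst.
apply: measurable_fun_pair.
- by apply: measurableT_comp; [exact: measurable_snd | exact: measurable_snd].
- by apply: measurableT_comp; [exact: measurable_fst | exact: measurable_snd].
Qed.

HB.instance Definition _ :=
  isMeasurableFun.Build _ _ _ _ flip measurable_flip.

(* The law of the flipped points when the points to be flipped have law q.  As
   flip is a measurable involution, every law on preference points arises so. *)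
Definition flip_law (q : probability (X * (Y * Y))%type R) :
    probability (X * (Y * Y))%type R :=
  distribution q flip.

Definition implicit_reward (beta : R) (piref p : X -> Y -> R) x y : R :=
  beta * ln (p x y / piref x y).

Definition margin (beta : R) (piref p : X -> Y -> R) (s : X * (Y * Y)) : R :=
  implicit_reward beta piref p s.1 s.2.1
  - implicit_reward beta piref p s.1 s.2.2.

Definition sigmoid (a : R) : R := (1 + expR (- a))^-1.

(* The cDPO loss as a function of the margin. *)
Definition cdpo (c g : R) : R :=
  (1 - c) * (- ln (sigmoid g)) - c * (- ln (sigmoid (- g))).

Definition cdpo_loss d (c beta : R) (piref : X -> Y -> R)
    (pi : 'rV[R]_d -> X -> Y -> R) (s : X * (Y * Y)) (t : 'rV[R]_d) : R :=
  cdpo c (margin beta piref (pi t) s).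

End preferences.

Section contamination.
Context {R : realType} {dS : measure_display} {S : measurableType dS}.

(* The absolute values only serve to make the weights nonnegative for every
   real eps; see contaminatedE. *)
Definition contaminated (pD pflip : probability S R) (eps : R) :
    {measure set S -> \bar R} :=
  measure_add (mscale `|1 - eps|%:nng pD) (mscale `|eps|%:nng pflip).

Lemma contaminatedE (pD pflip : probability S R) (eps : R) (A : set S) :
  0 <= eps -> eps <= 1 ->
  contaminated pD pflip eps A = ((1 - eps)%:E * pD A + eps%:E * pflip A)%E.
Proof.
move=> e0 e1; rewrite [LHS]measure_addE /= /mscale /=.
by rewrite !ger0_norm// subr_ge0.
Qed.

Definition risk d (p : {measure set S -> \bar R}) (l : S -> 'rV[R]_d -> R)
    (t : 'rV[R]_d) : R :=
  \int[p]_s l s t.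

Definition vexpectation d (p : {measure set S -> \bar R}) (f : S -> 'rV[R]_d) :
    'rV[R]_d :=
  \row_j \int[p]_s f s 0 j.

End contamination.

(* Main.v *)
Require Import Defs.
From mathcomp Require Import all_boot all_order all_algebra.
From mathcomp Require Import all_classical all_reals all_analysis.
From mathcomp Require Import measurable_realfun ring lra.
Import Order.TTheory GRing.Theory Num.Theory.
Import numFieldNormedType.Exports.
Local Open Scope classical_set_scope.
Local Open Scope ring_scope.

(* The derivative of the loss in the margin is
   cdpo_slope c g = (1 - 2 c) sigmoid g - (1 - c), which tends to -(1 - c) <> 0
   as g -> -oo.  Hence on the flipped data the mean loss gradient is
   asymptotically -(1 - c) times the mean margin gradient, and it suffices to
   bound the former by a fixed multiple of the influence.

   This bound needs neither second derivatives nor differentiation under the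
   integral sign.  The per-sample gradient is K-Lipschitz near tstar, uniformly
   in the sample, so the risk has a first-order expansion with error K h^2 and
   its minimizers satisfy (1 - eps) G_D + eps G_flip = 0 at th eps, where G_D
   and G_flip are the mean gradients.  Since G_D tstar = 0, this gives
   eps |G_flip (th eps)| <= K |th eps - tstar|; dividing by eps and letting
   eps -> 0 yields |G_flip tstar| <= K |influence|. *)

(** * Comparison of the sup norm with the Euclidean norm *)

Section norms.
Context {R : realType} {d : nat}.
Implicit Types v : 'rV[R]_d.

Lemma ler_coord_norm v (j : 'I_d) : `|v 0 j| <= `|v|.
Proof.
rewrite [leRHS]/Num.Def.normr/= mx_normrE.
exact: (le_bigmax 0 (fun i : 'I_1 * 'I_d => `|v i.1 i.2|) (0, j)).
Qed.

Lemma norm_le_coord v (r : R) : 0 <= r -> (forall j, `|v 0 j| <= r) -> `|v| <= r.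
Proof.
move=> r0 vr; rewrite [leLHS]/Num.Def.normr/= mx_normrE.
by apply/bigmax_leP; split => //= -[i j] _; rewrite ord1.
Qed.

Lemma norm_delta_le1 (j : 'I_d) : `|delta_mx 0 j : 'rV[R]_d| <= 1.
Proof.
apply: norm_le_coord => // k; rewrite mxE eqxx/=.
by case: eqP => _; rewrite ?normr0 ?normr1.
Qed.

Lemma ler_coord_enorm v j : `|v 0 j| <= enorm v.
Proof.
rewrite -[leLHS]sqrtr_sqr; apply: ler_wsqrtr.
rewrite (bigD1 j)//= lerDl; apply: sumr_ge0 => i _.
exact: sqr_ge0.
Qed.

Lemma enorm_ge0 v : 0 <= enorm v.
Proof. exact: sqrtr_ge0. Qed.

Lemma norm_le_enorm v : `|v| <= enorm v.
Proof. by apply: norm_le_coord (enorm_ge0 v) (ler_coord_enorm v). Qed.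

(** With [s] the sum on the right, each square satisfies [v_i ^ 2 <= |v_i| * s]; summing gives
    [s ^ 2]. *)
Lemma enorm_le_sum v : enorm v <= \sum_(j < d) `|v 0 j|.
Proof.
have s0 : 0 <= \sum_(j < d) `|v 0 j| by apply: sumr_ge0 => i _.
rewrite -[leRHS]ger0_norm// -[leRHS]sqrtr_sqr; apply: ler_wsqrtr.
rewrite [leRHS]expr2 mulr_suml; apply: ler_sum => i _.
rewrite -[leLHS]ger0_norm ?sqr_ge0// normrX expr2 ler_wpM2l//.
by rewrite (bigD1 i)//= lerDl; apply: sumr_ge0 => k _.
Qed.

Lemma sum_norm_le v : \sum_(j < d) `|v 0 j| <= d%:R * `|v|.
Proof.
apply: (@le_trans _ _ (\sum_(j < d) `|v|)).
  by apply: ler_sum => j _; exact: ler_coord_norm.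
by rewrite sumr_const card_ord mulr_natl.
Qed.

End norms.

(** * Derivatives and mean values along line segments *)

Section lines.
Context {R : realType} {d : nat}.
Implicit Types (f : 'rV[R]_d -> R) (t v : 'rV[R]_d).

(** The two difference quotients are the same function, so the directional derivative alone suffices
    and no chain rule is invoked. *)
Lemma is_derive_line f t v (h : R) : derivable f (h *: v + t) v ->
  is_derive h 1 (fun k => f (k *: v + t)) ('D_v f (h *: v + t)).
Proof.
move=> df.
have E : (fun k : R => k^-1 *: (((fun k => f (k *: v + t)) \o shift h) (k *: 1) - f (h *: v + t)))
  = (fun k : R => k^-1 *: ((f \o shift (h *: v + t)) (k *: v) - f (h *: v + t))).
  by apply/funext => k /=; rewrite [k *: 1]mulr1 scalerDl addrA.
by split; rewrite /derivable /derive E.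
Qed.

Lemma mean_value_line f t v (D : R -> R) :
  (forall h : R, 0 <= h <= 1 -> is_derive h 1 (fun k => f (k *: v + t)) (D h)) ->
  exists2 h : R, 0 <= h <= 1 & f (v + t) - f t = D h.
Proof.
move=> fD; have [||x x01] := @MVT_segment _ (fun k => f (k *: v + t)) D 0 1 ler01.
- by move=> x; rewrite in_itv/= => /andP[x0 x1]; apply: fD; rewrite !ltW.
- apply: derivable_within_continuous => x; rewrite in_itv/= => x01.
  by case: (fD x x01).
by rewrite scale1r scale0r add0r subr0 mulr1 => ->; exists x.
Qed.

Lemma derive_coord f t v : differentiable f t ->
  'D_v f t = \sum_(j < d) v 0 j * 'D_(delta_mx 0 j) f t.
Proof.
move=> df; rewrite deriveE// {1}(row_sum_delta v) linear_sum.
by apply: eq_bigr => j _; rewrite linearZ/= deriveE.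
Qed.

Lemma derive_norm_le f t v (B : R) : differentiable f t ->
  (forall j, `|'D_(delta_mx 0 j) f t| <= B) -> `|'D_v f t| <= d%:R * B * `|v|.
Proof.
move=> df fB; rewrite derive_coord// (le_trans (ler_norm_sum _ _ _))//.
apply: (@le_trans _ _ (\sum_(j < d) B * `|v|)).
  apply: ler_sum => j _; rewrite normrM mulrC.
  by apply: ler_pM => //; exact: ler_coord_norm.
by rewrite sumr_const card_ord -mulrA mulr_natl.
Qed.

Lemma segment_norm_le t v (h : R) : 0 <= h <= 1 -> `|h *: v + t - t| <= `|v|.
Proof.
move=> /andP[h0 h1]; rewrite addrK normrZ ger0_norm//.
by rewrite ler_piMl.
Qed.

(** Balls are convex: [h *: v + t] is the convex combination of [v + t] and [t] with weights [h] and
    [1 - h]. *)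
Lemma segment_in_ball t0 (r : R) t v (h : R) : 0 <= h <= 1 ->
  `|t - t0| < r -> `|v + t - t0| < r -> `|h *: v + t - t0| < r.
Proof.
move=> /andP[h0 h1] tr vtr.
have -> : h *: v + t - t0 = h *: (v + t - t0) + (1 - h) *: (t - t0).
  by apply/rowP => j; rewrite !mxE; ring.
apply: (le_lt_trans (ler_normD _ _)); rewrite !normrZ !ger0_norm ?subr_ge0//.
(* The strict inequality is kept by the term of weight [h], which requires [h > 0]; the case [h = 0]
   is therefore split off. *)
have [->|hn] := eqVneq h 0; first by rewrite mul0r add0r subr0 mul1r.
have h_gt0 : 0 < h by rewrite lt_def hn.
rewrite -[ltRHS](subrK (h * r)) addrC [ltRHS]addrC.
have -> : r - h * r = (1 - h) * r by ring.
by rewrite addrC; apply: ltr_leD; [rewrite ltr_pM2l|rewrite ler_wpM2l ?subr_ge0// ltW].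
Qed.

End lines.

(** * The sigmoid and the derivative of the cDPO loss in the margin *)

Definition cdpo_slope {R : realType} (c g : R) : R :=
  (1 - 2 * c) * sigmoid g - (1 - c).

Section sigmoid_cdpo.
Context {R : realType}.
Implicit Types a b c g : R.

Lemma sigmoid_gt0 a : 0 < sigmoid a.
Proof. by rewrite invr_gt0 addr_gt0// expR_gt0. Qed.

Lemma sigmoid_le1 a : sigmoid a <= 1.
Proof. by rewrite invf_le1 ?addr_gt0 ?expR_gt0// lerDl expR_ge0. Qed.

Lemma sigmoid_le_expR a : sigmoid a <= expR a.
Proof.
rewrite /sigmoid -[leRHS]invrK -expRN lef_pV2 ?posrE ?addr_gt0 ?expR_gt0//.
by rewrite lerDr.
Qed.

Lemma sigmoidN a : sigmoid (- a) = 1 - sigmoid a.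
Proof.
rewrite /sigmoid opprK expRN; have := expR_gt0 a.
by move: (expR a) => x x0; field; rewrite ?gt_eqF ?addr_gt0//; lra.
Qed.

Lemma is_derive_sigmoid a :
  is_derive a 1 (@sigmoid R) (sigmoid a * (1 - sigmoid a)).
Proof.
have E0 : 1 + expR (- a) != 0 by rewrite gt_eqF// addr_gt0// expR_gt0.
have DE : is_derive a 1 (fun x => expR (- x)) (expR (- a) * - 1).
  exact: (@is_derive1_comp R expR -%R).
have D : is_derive a 1 (fun x => 1 + expR (- x)) (0 + expR (- a) * - 1).
  exact: is_deriveD.
rewrite (_ : sigmoid = fun x => (1 + expR (- x))^-1)//.
refine (is_derive_eq (@is_deriveV R (fun x => 1 + expR (- x)) _ _ _ E0 D) _).
rewrite /sigmoid /GRing.scale/=; move: E0; move: (expR (- a)) => x x0.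
by field.
Qed.

Lemma is_derive_ln_sigmoid a :
  is_derive a 1 (fun x => ln (sigmoid x)) (1 - sigmoid a).
Proof.
have D := is_derive1_comp (is_derive1_ln (sigmoid_gt0 a)) (is_derive_sigmoid a).
by refine (is_derive_eq D _); rewrite mulKf// gt_eqF// sigmoid_gt0.
Qed.

Lemma is_derive_cdpo c g : is_derive g 1 (@cdpo R c) (cdpo_slope c g).
Proof.
have D1 := is_derive_ln_sigmoid g.
have D2 : is_derive g 1 (fun x => ln (sigmoid (- x))) ((1 - sigmoid (- g)) * -1).
  exact: (is_derive1_comp (is_derive_ln_sigmoid (- g))).
have D : is_derive g 1 (@cdpo R c)
    ((1 - c) *: - (1 - sigmoid g) - c *: - ((1 - sigmoid (- g)) * -1)).
  apply: is_deriveB.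
refine (is_derive_eq D _); rewrite /cdpo_slope sigmoidN /GRing.scale/=; ring.
Qed.

(** The slope is affine in [sigmoid g], with value [-(1 - c)] at 0 and [-c] at 1, and both lie in
    [[-1, 0]]. *)
Lemma norm_cdpo_slope_le1 c g : 0 <= c -> c < 1 -> `|cdpo_slope c g| <= 1.
Proof.
move=> c0 c1; rewrite /cdpo_slope ler_norml.
have := sigmoid_gt0 g; have := sigmoid_le1 g; move: (sigmoid g) => s s1 s0.
by apply/andP; split; nra.
Qed.

(** Both [|1 - 2 c|] and the derivative [sigmoid * (1 - sigmoid)] are at most 1. *)
Lemma cdpo_slope_lipschitz c a b : 0 <= c -> c < 1 ->
  `|cdpo_slope c a - cdpo_slope c b| <= `|a - b|.
Proof.
move=> c0 c1.
have -> : cdpo_slope c a - cdpo_slope c b = (1 - 2 * c) * (sigmoid a - sigmoid b).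
  by rewrite /cdpo_slope; ring.
rewrite normrM (@le_trans _ _ (1 * `|sigmoid a - sigmoid b|))//.
  by apply: ler_wpM2r => //; rewrite ler_norml; apply/andP; split; lra.
rewrite mul1r; wlog ba : a b / b <= a => [H|].
  case: (leP b a) => [|/ltW] /H//; by rewrite distrC [leRHS]distrC.
have [||x _ ->] := @MVT_segment _ (@sigmoid R) (fun x => sigmoid x * (1 - sigmoid x)) b a ba.
- by move=> x _; exact: is_derive_sigmoid.
- by apply: derivable_within_continuous => x _; case: (is_derive_sigmoid x).
rewrite normrM ler_piMl// ler_norml.
have := sigmoid_gt0 x; have := sigmoid_le1 x; move: (sigmoid x) => s s1 s0.
by apply/andP; split; nra.
Qed.

(** The gap to the limit is [(1 - 2 c) * sigmoid a], and the sigmoid decays at least as fast as the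
    exponential at minus infinity. *)
Lemma cdpo_slope_saturates c a : 0 <= c -> c < 1 ->
  `|cdpo_slope c a + (1 - c)| <= expR a.
Proof.
move=> c0 c1; rewrite /cdpo_slope subrK normrM.
rewrite (le_trans _ (sigmoid_le_expR a))//.
rewrite [`|sigmoid a|]gtr0_norm ?sigmoid_gt0// ler_piMl ?(ltW (sigmoid_gt0 _))//.
by rewrite ler_norml; apply/andP; split; lra.
Qed.

Lemma measurable_cdpo_slope c : measurable_fun setT (@cdpo_slope R c).
Proof.
apply: continuous_measurable_fun => x.
apply: (@cvgB _ _ _ _ _ (fun g => (1 - 2 * c) * sigmoid g)); last exact: cvg_cst.
apply: cvgM; first exact: cvg_cst.
apply/differentiable_continuous/derivable1_diffP.
by case: (is_derive_sigmoid x).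
Qed.

End sigmoid_cdpo.

(** For differentiable [m] this is the [j]-th partial derivative of [cdpo c \o m], written by the
    chain rule so that slope and margin can be estimated separately. *)
Definition loss_partial {R : realType} {d : nat} (c : R) (m : 'rV[R]_d -> R)
    (j : 'I_d) (t : 'rV[R]_d) : R :=
  cdpo_slope c (m t) * 'D_(delta_mx 0 j) m t.

(** * Estimates for the loss gradient of a single sample *)

Section loss_estimates.
Context {R : realType} {d : nat}.
Variables (c B Lam r : R) (t0 : 'rV[R]_d) (m : 'rV[R]_d -> R).
Hypothesis (c_ge0 : 0 <= c) (c_lt1 : c < 1).
Hypothesis m_diff : forall t : 'rV[R]_d, `|t - t0| < r -> differentiable m t.
Hypothesis m_bound : forall (t : 'rV[R]_d) (j : 'I_d), `|t - t0| < r ->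
  `|'D_(delta_mx 0 j) m t| <= B.
Hypothesis m_lip : forall (t1 t2 : 'rV[R]_d) (j : 'I_d), `|t1 - t0| < r -> `|t2 - t0| < r ->
  `|'D_(delta_mx 0 j) m t1 - 'D_(delta_mx 0 j) m t2| <= Lam * `|t1 - t2|.

Local Notation psi := (loss_partial c m).
Local Notation K := (d%:R * B * B + Lam).

Lemma margin_lipschitz t1 t2 : `|t1 - t0| < r -> `|t2 - t0| < r ->
  `|m t1 - m t2| <= d%:R * B * `|t1 - t2|.
Proof.
move=> t1r t2r; pose v := t1 - t2.
have inb (h : R) : 0 <= h <= 1 -> `|h *: v + t2 - t0| < r.
  by move=> h01; apply: segment_in_ball; rewrite // subrK.
have [|h h01] := @mean_value_line _ _ m t2 v (fun h => 'D_v m (h *: v + t2)).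
  move=> h h01; apply: is_derive_line.
  by apply: diff_derivable; apply: m_diff; exact: inb.
rewrite subrK => ->; apply: derive_norm_le; first by apply: m_diff; exact: inb.
by move=> j; apply: m_bound; exact: inb.
Qed.

Lemma norm_loss_partial_le t j : `|t - t0| < r -> `|psi j t| <= B.
Proof.
move=> tr; rewrite normrM (le_trans _ (m_bound _ j tr))// ler_piMl//.
exact: norm_cdpo_slope_le1.
Qed.

(** Product rule for Lipschitz constants: the slope varies at rate [d * B] against a partial bounded
    by [B], and the partial varies at rate [Lam] against a slope bounded by 1. *)
Lemma loss_partial_lipschitz t1 t2 j : `|t1 - t0| < r -> `|t2 - t0| < r ->
  `|psi j t1 - psi j t2| <= K * `|t1 - t2|.
Proof.
move=> t1r t2r; rewrite /loss_partial.
set a := cdpo_slope _ _; set b := cdpo_slope _ _.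
set x := 'D__ _ _; set y := 'D__ _ _.
have -> : a * x - b * y = (a - b) * x + b * (x - y) by ring.
rewrite (le_trans (ler_normD _ _))// [leRHS]mulrDl; apply: lerD; rewrite normrM.
  rewrite mulrAC; apply: ler_pM => //; last exact: m_bound.
  exact: le_trans (cdpo_slope_lipschitz _ _ _ c_ge0 c_lt1) (margin_lipschitz _ _ t1r t2r).
rewrite (le_trans _ (m_lip _ _ j t1r t2r))// ler_piMl//.
exact: norm_cdpo_slope_le1.
Qed.

(** By the mean value theorem the increment is [h] times the partial at an intermediate point;
    moving that point back to [t] changes the partial by at most [K * |h|]. *)
Lemma loss_taylor t j (h : R) : 0 <= K ->
  `|t - t0| < r -> `|h *: delta_mx 0 j + t - t0| < r ->
  `|cdpo c (m (h *: delta_mx 0 j + t)) - cdpo c (m t) - h * psi j t|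
    <= K * h ^+ 2.
Proof.
move=> K0 tr htr; pose v : 'rV[R]_d := h *: delta_mx 0 j.
have inb (k : R) : 0 <= k <= 1 -> `|k *: v + t - t0| < r.
  by move=> k01; apply: segment_in_ball.
have [|k k01] := @mean_value_line _ _ (cdpo c \o m) t v
    (fun k => h * psi j (k *: v + t)).
  move=> k k01.
  have dm := m_diff _ (inb k k01).
  have D := is_derive1_comp (is_derive_cdpo c (m (k *: v + t)))
    (is_derive_line m t v k (diff_derivable dm)).
  refine (is_derive_eq D _); rewrite /loss_partial.
  move: (k *: v + t) dm => x dm.
  (* Linearity of the differential extracts the factor [h] from the derivative in the direction
     [h *: delta_mx 0 j]. *)
  by rewrite deriveE// /v linearZ/= -deriveE// [LHS]mulrCA.
rewrite /= => ->; rewrite -mulrBr normrM.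
apply: (@le_trans _ _ (`|h| * (K * `|h|))); last first.
  by rewrite mulrCA -normrM -expr2 ger0_norm// sqr_ge0.
apply: ler_wpM2l => //.
apply: (le_trans (loss_partial_lipschitz _ _ _ (inb k k01) tr)).
apply: ler_wpM2l => //; apply: (le_trans (segment_norm_le _ _ _ k01)).
by rewrite normrZ ler_piMr// norm_delta_le1.
Qed.

End loss_estimates.

(** * Integration against mixtures and probabilities; a stationarity criterion *)

Section integrals.
Context {R : realType} {dS : measure_display} {S : measurableType dS}.

Lemma integrable_mscale (mu : {measure set S -> \bar R}) (k : {nonneg R})
    (f : S -> \bar R) :
  mu.-integrable setT f -> (mscale k mu).-integrable setT f.
Proof.
move=> /integrableP[mf foo]; apply/integrableP; split => //.
rewrite ge0_integral_mscale//; last exact: measurableT_comp.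
by rewrite lte_mul_pinfty// lee_fin.
Qed.

(** Scaling is applied to the positive and negative parts separately; integrability makes both
    integrals finite, so their difference can be recombined. *)
Lemma Rintegral_mscale (mu : {measure set S -> \bar R}) (k : {nonneg R})
    (f : S -> R) :
  mu.-integrable setT (EFin \o f) ->
  \int[mscale k mu]_s f s = k%:num * \int[mu]_s f s.
Proof.
move=> intf; have mf := measurable_int _ intf.
have fp : (\int[mu]_s (EFin \o f)^\+%E s)%E \is a fin_num.
  exact: integrable_pos_fin_num.
have fn : (\int[mu]_s (EFin \o f)^\-%E s)%E \is a fin_num.
  exact: integrable_neg_fin_num.
rewrite /Rintegral integralE [in RHS]integralE.
rewrite !ge0_integral_mscale//; last 2 first.
- exact: measurable_funeneg.
- exact: measurable_funepos.
by rewrite -muleBr ?fin_num_adde_defr// fineM// fin_numB fp fn.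
Qed.

Lemma Rintegral_contaminated (p p' : probability S R) (eps : R) (f : S -> R) :
  0 <= eps -> eps <= 1 ->
  p.-integrable setT (EFin \o f) -> p'.-integrable setT (EFin \o f) ->
  \int[contaminated p p' eps]_s f s
  = (1 - eps) * \int[p]_s f s + eps * \int[p']_s f s.
Proof.
move=> e0 e1 intp intp'.
rewrite {1}/Rintegral (integral_measure_add measurableT
  (integrable_mscale _ _ _ intp) (integrable_mscale _ _ _ intp')).
rewrite fineD; last 2 first.
- exact: (integrable_fin_num measurableT (integrable_mscale _ _ _ intp)).
- exact: (integrable_fin_num measurableT (integrable_mscale _ _ _ intp')).
congr (_ + _); rewrite [LHS](Rintegral_mscale _ _ _ _)//=.
  by rewrite ger0_norm// subr_ge0.
by rewrite ger0_norm.
Qed.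

Lemma bounded_integrable (p : probability S R) (f : S -> R) (B : R) :
  measurable_fun setT f -> (forall s, `|f s| <= B) ->
  p.-integrable setT (EFin \o f).
Proof.
move=> mf fB; apply: (@le_integrable _ _ _ _ _ _ _ (cst B%:E)) => //.
- exact/measurable_EFinP.
- by move=> s _ /=; rewrite lee_fin (le_trans (fB s))// ler_norm.
- exact: (finite_measure_integrable_cst p B).
Qed.

(** A probability has mass 1. The bound is asked only almost everywhere, since the limiting regime
    controls the margin only up to null sets. *)
Lemma norm_Rintegral_le (p : probability S R) (f : S -> R) (B : R) :
  p.-integrable setT (EFin \o f) -> 0 <= B ->
  {ae p, forall s, `|f s| <= B} -> `|\int[p]_s f s| <= B.
Proof.
move=> intf B0 fB; have mf := measurable_int _ intf.
rewrite -lee_fin EFin_normr_Rintegral//.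
apply: (le_trans (le_abse_integral _ _ _)) => //.
apply: (@le_trans _ _ (\int[p]_s (cst B%:E s)))%E.
  apply: ae_ge0_le_integral => //=.
  - by apply/measurable_EFinP; apply: measurableT_comp => //; exact/measurable_EFinP.
  - by apply: filterS fB => s + _; rewrite lee_fin.
by rewrite integral_cst//= probability_setT mule1.
Qed.

Lemma stationary_of_quadratic_lower_bound (a K del : R) : 0 <= K -> 0 < del ->
  (forall h, `|h| < del -> 0 <= h * a + K * h ^+ 2) -> a = 0.
Proof.
move=> K0 del0 H; apply/eqP/negP => /negP a0.
(* The test point is [h = - tau * a]. The first bound on [tau] gives [|h| <= del / 2], the second
   [K * tau < 1], so that the quadratic form is negative there. *)
pose tau := Num.min (del / (2 * `|a|)) (2 * (K + 1))^-1.
have a_gt0 : 0 < `|a| by rewrite normr_gt0.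
have K1 : 0 < 2 * (K + 1) by lra.
have tau0 : 0 < tau by rewrite lt_min divr_gt0 ?mulr_gt0//= invr_gt0.
have t1 : tau * (2 * `|a|) <= del by rewrite -ler_pdivlMr ?mulr_gt0// ge_min lexx.
have t2 : tau * (2 * (K + 1)) <= 1.
  by rewrite -ler_pdivlMr// mul1r ge_min lexx orbT.
have small : `|- (tau * a)| < del.
  by rewrite normrN normrM gtr0_norm//; nra.
have := H _ small.
have : 0 < a ^+ 2 by rewrite exprn_even_gt0.
have -> : - (tau * a) * a + K * (- (tau * a)) ^+ 2 = (tau * a ^+ 2) * (K * tau - 1) by ring.
move=> a2; have : 0 < tau * a ^+ 2 by rewrite mulr_gt0.
move: (tau * a ^+ 2) => x x0; nra.
Qed.

End integrals.

(** A derivative is the pointwise limit of difference quotients along a sequence of steps, each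
    quotient being measurable in the sample. *)
Lemma measurable_partial {R : realType} {dS : measure_display}
    {S : measurableType dS} {d : nat} (f : S -> 'rV[R]_d -> R)
    (t v : 'rV[R]_d) :
  (\forall t' \near t, measurable_fun setT (f ^~ t')) ->
  (forall s, derivable (f s) t v) ->
  measurable_fun setT (fun s => 'D_v (f s) t).
Proof.
move=> mf df.
have near_line : \forall h \near (0 : R), measurable_fun setT (f ^~ (h *: v + t)).
  have : (h *: v + t) @[h --> (0 : R)] --> (0 : R) *: v + t.
    by apply: cvgD; [apply: cvgZr_tmp; exact: cvg_id|exact: cvg_cst].
  by rewrite scale0r add0r => /(_ _ mf).
have [e /= e0 me] := (nbhs_normP _ _).1 near_line.
(* These steps are nonzero, tend to 0 and stay below [e], inside the region where measurability is
   known. *)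
pose u (n : nat) : R := e / 2 * harmonic n.
have u_gt0 n : 0 < u n by rewrite mulr_gt0 ?harmonic_gt0// divr_gt0.
have ule n : u n < e.
  rewrite (@le_lt_trans _ _ (e / 2))//; last by lra.
  by rewrite ler_piMr//; [lra|rewrite /harmonic invf_le1// ler1n].
have u0 : u n @[n --> \oo] --> 0.
  have : u n @[n --> \oo] --> e / 2 * 0 by apply: cvgMl_tmp; exact: cvg_harmonic.
  by rewrite mulr0.
pose q n s := (u n)^-1 *: (f s (u n *: v + t) - f s t).
apply: (@measurable_fun_cvg _ _ _ _ q).
- move=> n; apply: measurable_funM => //.
  apply: measurable_funB; last exact: nbhs_singleton mf.
  by apply: me; rewrite /ball_/= sub0r normrN gtr0_norm.
- move=> s _; have /cvgr_dnbhsP := df s; apply; split => // n.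
  by rewrite gt_eqF.
Qed.

(** * Mean loss gradients, stationarity and the influence bound *)

Section mean_gradient.
Context {R : realType} {dS : measure_display} {S : measurableType dS} {d : nat}.
Variables (c B Lam r : R) (t0 : 'rV[R]_d) (m : S -> 'rV[R]_d -> R).
Hypothesis (c_ge0 : 0 <= c) (c_lt1 : c < 1).
Hypothesis (B_ge0 : 0 <= B) (Lam_ge0 : 0 <= Lam) (r_gt0 : 0 < r).
Hypothesis m_diff : forall s (t : 'rV[R]_d), `|t - t0| < r ->
  differentiable (m s) t.
Hypothesis m_bound : forall s (t : 'rV[R]_d) (j : 'I_d), `|t - t0| < r ->
  `|'D_(delta_mx 0 j) (m s) t| <= B.
Hypothesis m_lip : forall s (t1 t2 : 'rV[R]_d) (j : 'I_d),
  `|t1 - t0| < r -> `|t2 - t0| < r ->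
  `|'D_(delta_mx 0 j) (m s) t1 - 'D_(delta_mx 0 j) (m s) t2|
    <= Lam * `|t1 - t2|.
Hypothesis m_meas : forall t : 'rV[R]_d, `|t - t0| < r ->
  measurable_fun setT (m ^~ t).

Local Notation K := (d%:R * B * B + Lam).

(** Component [j] of the mean gradient ([G_D] or [G_flip]), taken as a mean of per-sample partials
    rather than as a derivative of the risk. *)
Definition mean_partial (p : probability S R) (j : 'I_d) (t : 'rV[R]_d) : R :=
  \int[p]_s loss_partial c (m s) j t.

Let K_ge0 : 0 <= K.
Proof. by rewrite addr_ge0// !mulr_ge0. Qed.

Lemma measurable_margin_partial (j : 'I_d) (t : 'rV[R]_d) : `|t - t0| < r ->
  measurable_fun setT (fun s => 'D_(delta_mx 0 j) (m s) t).
Proof.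
move=> tr; apply: measurable_partial; last first.
  by move=> s; apply: diff_derivable; exact: m_diff.
have : \forall t' \near t, `|t' - t0| < r.
  apply/nbhs_normP; exists (r - `|t - t0|) => /=; first by rewrite subr_gt0.
  move=> t' /=; rewrite /ball_/= => tt'.
  rewrite -(subrK t t') -addrA (le_lt_trans (ler_normD _ _))//.
  by rewrite distrC -ltrBrDr.
by apply: filterS => t'; exact: m_meas.
Qed.

Lemma integrable_margin_partial (p : probability S R) (j : 'I_d)
    (t : 'rV[R]_d) : `|t - t0| < r ->
  p.-integrable setT (fun s => ('D_(delta_mx 0 j) (m s) t)%:E).
Proof.
move=> tr; apply: (bounded_integrable _ _ B).
  exact: measurable_margin_partial.
by move=> s; exact: m_bound.
Qed.

Lemma integrable_loss_partial (p : probability S R) (j : 'I_d)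
    (t : 'rV[R]_d) : `|t - t0| < r ->
  p.-integrable setT (fun s => (loss_partial c (m s) j t)%:E).
Proof.
move=> tr; apply: (bounded_integrable _ _ B).
  apply: measurable_funM; last exact: measurable_margin_partial.
  by apply: (measurableT_comp (measurable_cdpo_slope c)); exact: m_meas.
move=> s; exact: (norm_loss_partial_le _ _ _ _ _ c_ge0 c_lt1 (m_bound s)).
Qed.

Lemma mean_partial_lipschitz (p : probability S R) (j : 'I_d)
    (t1 t2 : 'rV[R]_d) : `|t1 - t0| < r -> `|t2 - t0| < r ->
  `|mean_partial p j t1 - mean_partial p j t2| <= K * `|t1 - t2|.
Proof.
move=> t1r t2r; rewrite /mean_partial -RintegralB//; last 2 first.
- exact: integrable_loss_partial.
- exact: integrable_loss_partial.
apply: norm_Rintegral_le.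
- exact: (integrableB measurableT (integrable_loss_partial p j _ t1r)
    (integrable_loss_partial p j _ t2r)).
- by rewrite mulr_ge0.
apply: aeW => s; exact: (loss_partial_lipschitz _ _ _ _ _ _ c_ge0 c_lt1 (m_diff s)
  (m_bound s) (m_lip s)).
Qed.

(** The error [K * h ^ 2] of [loss_taylor] is the same for every sample, so it survives integration
    against a probability. This replaces differentiation under the integral sign. *)
Lemma risk_taylor (p : probability S R) (j : 'I_d) (t : 'rV[R]_d) (h : R) :
  (forall t : 'rV[R]_d, `|t - t0| < r ->
     p.-integrable setT (fun s => (cdpo c (m s t))%:E)) ->
  `|t - t0| < r -> `|h *: delta_mx 0 j + t - t0| < r ->
  `|\int[p]_s cdpo c (m s (h *: delta_mx 0 j + t)) - \int[p]_s cdpo c (m s t)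
    - h * mean_partial p j t| <= K * h ^+ 2.
Proof.
move=> intl tr htr; rewrite /mean_partial.
have ip := integrable_loss_partial p j _ tr.
have ihp : p.-integrable setT (EFin \o (fun s => h * loss_partial c (m s) j t)).
  exact: (integrableZl measurableT h ip).
have id := integrableB measurableT (intl _ htr) (intl _ tr).
rewrite -(RintegralZl h measurableT ip) -RintegralB//; last 2 first.
- exact: intl.
- exact: intl.
rewrite -RintegralB//.
apply: norm_Rintegral_le; first exact: (integrableB measurableT id ihp).
  by rewrite mulr_ge0// sqr_ge0.
apply: aeW => s; exact: (loss_taylor _ _ _ _ _ _ c_ge0 c_lt1 (m_diff s)
  (m_bound s) (m_lip s)).
Qed.

(** Weighting the two risk expansions by [1 - eps] and [eps] keeps the error [K * h ^ 2]; minimality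
    then gives the quadratic lower bound whose linear coefficient must vanish. *)
Lemma contaminated_stationary (p p' : probability S R) (eps : R) (j : 'I_d)
    (t : 'rV[R]_d) :
  (forall t : 'rV[R]_d, `|t - t0| < r ->
     p.-integrable setT (fun s => (cdpo c (m s t))%:E)) ->
  (forall t : 'rV[R]_d, `|t - t0| < r ->
     p'.-integrable setT (fun s => (cdpo c (m s t))%:E)) ->
  0 <= eps -> eps <= 1 -> `|t - t0| < r ->
  (forall t' : 'rV[R]_d, `|t' - t0| < r ->
     risk (contaminated p p' eps) (fun s t => cdpo c (m s t)) t
     <= risk (contaminated p p' eps) (fun s t => cdpo c (m s t)) t') ->
  (1 - eps) * mean_partial p j t + eps * mean_partial p' j t = 0.
Proof.
move=> intp intp' e0 e1 tr tmin.
(* The radius [r - |t - t0|] keeps every perturbed point in the ball. *)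
apply: (stationary_of_quadratic_lower_bound _ K (r - `|t - t0|)) => //.
  by rewrite subr_gt0.
move=> h hr.
have htr : `|h *: delta_mx 0 j + t - t0| < r.
  rewrite -addrA (le_lt_trans (ler_normD _ _))// -ltrBrDr (le_lt_trans _ hr)//.
  by rewrite normrZ ler_piMr// norm_delta_le1.
have riskE (u : 'rV[R]_d) : `|u - t0| < r ->
    risk (contaminated p p' eps) (fun s t => cdpo c (m s t)) u =
    (1 - eps) * \int[p]_s cdpo c (m s u) + eps * \int[p']_s cdpo c (m s u).
  by move=> ur; apply: Rintegral_contaminated => //; [exact: intp|exact: intp'].
have := tmin _ htr; rewrite !riskE//.
have := risk_taylor _ j _ h intp tr htr; have := risk_taylor _ j _ h intp' tr htr.
rewrite !ler_norml.
set x := (\int[p]_s _); set y := (\int[p]_s _); set x' := (\int[p']_s _).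
set y' := (\int[p']_s _).
move: (mean_partial _ _ _) (mean_partial _ _ _) => a a'.
move: (K * h ^+ 2) => k /andP[_ H'] /andP[_ H] xy.
have := ler_wpM2l e0 H'; have e1' : 0 <= 1 - eps by rewrite subr_ge0.
have := ler_wpM2l e1' H; nra.
Qed.

Lemma mean_partial_le_influence (p p' : probability S R) (j : 'I_d)
    (th : R -> 'rV[R]_d) :
  has_influence th -> th 0 = t0 ->
  (forall eps : R, 0 <= eps -> eps < 2^-1 -> `|th eps - t0| < r ->
     (1 - eps) * mean_partial p j (th eps) + eps * mean_partial p' j (th eps)
     = 0) ->
  `|mean_partial p' j t0| <= K * `|influence th|.
Proof.
move=> inf th0 stat.
(* Clean optimality is the case [eps = 0] of stationarity. *)
have stat0 : mean_partial p j t0 = 0.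
  have := stat 0; rewrite th0 subrr normr0 mul0r addr0 subr0 mul1r.
  by apply; rewrite ?invr_gt0.
pose iq := influence_quotient th.
have iqE (eps : R) : 0 < eps -> th eps - t0 = eps *: iq eps.
  by move=> e0; rewrite /iq /influence_quotient th0 scalerA divff ?scale1r// gt_eqF.
have iq_cvg : iq eps @[eps --> 0^'+] --> influence th := inf.
have eps_cvg : (eps : R) @[eps --> 0^'+] --> (0 : R).
  exact: cvg_at_right_filter cvg_id.
(* Continuity of the curve at 0 follows from convergence of its quotient: [th eps - t0] is [eps]
   times a convergent quantity. *)
have small : \forall eps \near (0 : R)^'+, `|th eps - t0| < r.
  have : `|eps *: iq eps| @[eps --> 0^'+] --> `|(0 : R) *: influence th|.
    by apply: cvg_norm; apply: cvgZ.
  rewrite scale0r normr0 => /cvgr_lt /(_ _ r_gt0).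
  move=> H; near=> eps; rewrite iqE//; first by near: eps.
(* The first term comes from stationarity after division by [eps]; the second is the cost of moving
   the flipped gradient from [th eps] to [t0], and vanishes in the limit. *)
have bnd : \forall eps \near (0 : R)^'+,
    `|mean_partial p' j t0| <= K * `|iq eps| + eps * (K * `|iq eps|).
  near=> eps.
  have e0 : 0 < eps by [].
  have er : `|th eps - t0| < r by near: eps.
  have eh : eps < 2^-1 by near: eps; apply: nbhs_right_lt; rewrite invr_gt0.
  have t0r : `|t0 - t0| < r by rewrite subrr normr0.
  have := stat eps (ltW e0) eh er.
  have := mean_partial_lipschitz p j _ _ er t0r.
  have := mean_partial_lipschitz p' j _ _ er t0r.
  rewrite stat0 subr0 iqE// normrZ gtr0_norm//.
  move: (mean_partial p' j (th eps)) (mean_partial p' j t0) (mean_partial p j (th eps)) => a a' b.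
  move: (`|iq eps|) => z H1 H2 H3.
  have : eps * `|a| <= eps * (K * z).
    rewrite -[X in X * `|a|](gtr0_norm e0) -normrM.
    have -> : eps * a = - ((1 - eps) * b) by lra.
    rewrite normrN normrM mulrCA (le_trans _ H2)// ler_piMl// ger0_norm; lra.
  rewrite ler_pM2l// => H4.
  have := ler_normB a (a - a'); rewrite opprB addrC subrK.
  move=> /le_trans; apply; apply: lerD => //.
  by rewrite mulrCA.
have lim : K * `|iq eps| + eps * (K * `|iq eps|) @[eps --> 0^'+]
    --> K * `|influence th| + 0 * (K * `|influence th|).
  have N : K * `|iq eps| @[eps --> 0^'+] --> K * `|influence th|.
    by apply: cvgM; [exact: cvg_cst|exact: cvg_norm].
  by apply: cvgD => //; apply: cvgM.
rewrite mul0r addr0 in lim.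
exact: (cvgr_to_ge lim bnd).
Unshelve. all: by end_near. Qed.

(** The combined integrand is [(slope + (1 - c)) * partial], with first factor at most [expR M]
    almost everywhere and second at most [B]. *)
Lemma mean_partial_saturates (p : probability S R) (j : 'I_d) (M : R) :
  {ae p, forall s, m s t0 <= M} ->
  `|mean_partial p j t0 + (1 - c) * \int[p]_s 'D_(delta_mx 0 j) (m s) t0|
    <= expR M * B.
Proof.
move=> mM; have t0r : `|t0 - t0| < r by rewrite subrr normr0.
have ip := integrable_margin_partial p j _ t0r.
have ip' := integrable_loss_partial p j _ t0r.
have ihp : p.-integrable setT
    (EFin \o (fun s => (1 - c) * 'D_(delta_mx 0 j) (m s) t0)).
  exact: (integrableZl measurableT (1 - c) ip).
rewrite -(RintegralZl (1 - c) measurableT ip) -RintegralD//.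
apply: norm_Rintegral_le; first exact: (integrableD measurableT ip' ihp).
  by rewrite mulr_ge0// expR_ge0.
apply: filterS mM => s sM; rewrite -mulrDl normrM.
apply: ler_pM => //; last exact: m_bound.
by rewrite (le_trans (cdpo_slope_saturates _ _ c_ge0 c_lt1))// ler_expR.
Qed.

End mean_gradient.

(** * From policy gradients to margin gradients *)

Section margin_bounds.
Context {R : realType} {dX dY : measure_display}.
Context {X : measurableType dX} {Y : measurableType dY}.
Context {nu : {measure set Y -> \bar R}} {d : nat}.
Variables (Theta : set 'rV[R]_d) (beta C L : R).
Variables (piref : X -> Y -> R) (pi : 'rV[R]_d -> X -> Y -> R).
Hypothesis (Theta_open : open Theta) (beta_gt0 : 0 < beta) (L_ge0 : 0 <= L).
Hypothesis piref_policy : is_policy nu piref.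
Hypothesis pi_policy : forall t, Theta t -> is_policy nu (pi t).
Hypothesis logpi_diff : forall x y t, Theta t ->
  differentiable (fun t' => ln (pi t' x y)) t.
Hypothesis logpi_bounded : forall x y t, Theta t ->
  enorm (grad (fun t' => ln (pi t' x y)) t) <= C.
Hypothesis logpi_lipschitz : forall x y t1 t2, Theta t1 -> Theta t2 ->
  enorm (grad (fun t' => ln (pi t' x y)) t1
         - grad (fun t' => ln (pi t' x y)) t2) <= L * enorm (t1 - t2).

Local Notation logpi x y := (fun t' => ln (pi t' x y)).

(** The reference policy contributes only an additive constant. Splitting the logarithms needs
    positivity of the policy, which holds near [t] because [Theta] is open. *)
Lemma derive_margin (s : X * (Y * Y)) (t v : 'rV[R]_d) : Theta t ->
  'D_v (fun t => margin beta piref (pi t) s) t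
  = beta * ('D_v (logpi s.1 s.2.1) t - 'D_v (logpi s.1 s.2.2) t).
Proof.
case: s => x [yw yl] Tt /=; have [ref0 _ _] := piref_policy.
pose k := ln (piref x yw) - ln (piref x yl).
have E : \forall t' \near t, margin beta piref (pi t') (x, (yw, yl))
    = beta * (logpi x yw t' - logpi x yl t' - k).
  have : \forall t' \near t, Theta t' by exact: open_nbhs_nbhs.
  apply: filterS => t' /pi_policy[pi0 _ _].
  rewrite /margin /implicit_reward /= !ln_div ?posrE//.
  by rewrite /k; ring.
rewrite (near_eq_derive _ E).
have d1 := derivableP (diff_derivable (v := v) (logpi_diff x yw _ Tt)).
have d2 := derivableP (diff_derivable (v := v) (logpi_diff x yl _ Tt)).
have D := is_deriveZ beta (is_deriveB (is_deriveB d1 d2) (is_derive_cst k t v)).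
rewrite (@derive_val _ _ _ _ _ _ _ D).
by rewrite subr0.
Qed.

Lemma margin_partial_bound (s : X * (Y * Y)) (t : 'rV[R]_d) (j : 'I_d) :
  Theta t ->
  `|'D_(delta_mx 0 j) (fun t => margin beta piref (pi t) s) t| <= 2 * beta * C.
Proof.
move=> Tt; rewrite derive_margin// normrM gtr0_norm//.
have b y : `|'D_(delta_mx 0 j) (logpi s.1 y) t| <= C.
  apply: le_trans (logpi_bounded s.1 y t Tt).
  by have := ler_coord_enorm (grad (logpi s.1 y) t) j; rewrite mxE.
rewrite -mulrA mulrCA ler_pM2l//.
have := b s.2.1; have := b s.2.2; have := ler_normB
  ('D_(delta_mx 0 j) (logpi s.1 s.2.1) t) ('D_(delta_mx 0 j) (logpi s.1 s.2.2) t).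
lra.
Qed.

(** The 2 counts the two responses; the factor [d] passes from the Euclidean norm of [t1 - t2] to
    its sup norm. *)
Lemma margin_partial_lipschitz (s : X * (Y * Y)) (t1 t2 : 'rV[R]_d)
    (j : 'I_d) : Theta t1 -> Theta t2 ->
  `|'D_(delta_mx 0 j) (fun t => margin beta piref (pi t) s) t1
    - 'D_(delta_mx 0 j) (fun t => margin beta piref (pi t) s) t2|
  <= 2 * beta * L * d%:R * `|t1 - t2|.
Proof.
move=> T1 T2; rewrite !derive_margin//.
pose D y (t : 'rV[R]_d) := 'D_(delta_mx 0 j) (logpi s.1 y) t.
have b y : `|D y t1 - D y t2| <= L * (d%:R * `|t1 - t2|).
  apply: (@le_trans _ _ (L * enorm (t1 - t2))).
    apply: le_trans (logpi_lipschitz s.1 y t1 t2 T1 T2).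
    have := ler_coord_enorm (grad (logpi s.1 y) t1 - grad (logpi s.1 y) t2) j.
    by rewrite !mxE.
  apply: ler_wpM2l => //.
  exact: le_trans (enorm_le_sum _) (sum_norm_le _).
rewrite -mulrBr normrM gtr0_norm//.
have -> : 2 * beta * L * d%:R * `|t1 - t2|
  = beta * (L * (d%:R * `|t1 - t2|) + L * (d%:R * `|t1 - t2|)) by ring.
rewrite ler_pM2l// -/(D _ _) -/(D _ _) -/(D s.2.2 t1) -/(D s.2.2 t2).
have -> : D s.2.1 t1 - D s.2.2 t1 - (D s.2.1 t2 - D s.2.2 t2)
  = (D s.2.1 t1 - D s.2.1 t2) - (D s.2.2 t1 - D s.2.2 t2) by ring.
by rewrite (le_trans (ler_normB _ _))// lerD.
Qed.

Lemma measurable_margin (t : 'rV[R]_d) : Theta t ->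
  measurable_fun [set: X * (Y * Y)] (margin beta piref (pi t)).
Proof.
move=> Tt; have [pi0 mpi _] := pi_policy _ Tt; have [ref0 mref _] := piref_policy.
have mln (p : X -> Y -> R) (y : X * (Y * Y) -> Y) :
    measurable_fun [set: X * Y] (fun xy => p xy.1 xy.2) ->
    measurable_fun setT y -> measurable_fun setT (fun s => ln (p s.1 (y s))).
  move=> mp my; apply: (@measurableT_comp _ _ _ _ _ _ (@ln R) _ (fun s => p s.1 (y s))) => //.
  apply: (@measurableT_comp _ _ _ _ _ _ (fun xy => p xy.1 xy.2) _ (fun s => (s.1, y s))) => //.
  by apply: measurable_fun_pair => //; exact: measurable_fst.
have mr (y : X * (Y * Y) -> Y) : measurable_fun setT y ->
    measurable_fun setT (fun s => implicit_reward beta piref (pi t) s.1 (y s)).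
  move=> my; rewrite /implicit_reward.
  rewrite (_ : (fun s => _)
    = (fun s => beta * (ln (pi t s.1 (y s)) - ln (piref s.1 (y s))))).
    by apply: measurable_funM => //; apply: measurable_funB; exact: mln.
  by apply/funext => s; rewrite ln_div ?posrE.
by apply: measurable_funB; apply: mr;
  apply: measurableT_comp; rewrite ?measurable_fst ?measurable_snd.
Qed.

End margin_bounds.

Theorem corollary4 (R : realType) (dX dY : measure_display)
  (X : measurableType dX) (Y : measurableType dY)
  (nu : {measure set Y -> \bar R}) (d : nat)
  (Theta : set 'rV[R]_d) (Theta_open : open Theta)
  (c beta C L : R) (c_ge0 : 0 <= c) (c_lt1 : c < 1) (beta_gt0 : 0 < beta)
  (C_gt0 : 0 < C) (L_gt0 : 0 < L)
  (* policies *)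
  (piref : X -> Y -> R) (piref_policy : is_policy nu piref)
  (pi : 'rV[R]_d -> X -> Y -> R)
  (pi_policy : forall t, Theta t -> is_policy nu (pi t))
  (logpi_diff : forall x y t, Theta t ->
    differentiable (fun t' => ln (pi t' x y)) t)
  (logpi_bounded : forall x y t, Theta t ->
    enorm (grad (fun t' => ln (pi t' x y)) t) <= C)
  (logpi_lipschitz : forall x y t1 t2, Theta t1 -> Theta t2 ->
    enorm (grad (fun t' => ln (pi t' x y)) t1
           - grad (fun t' => ln (pi t' x y)) t2) <= L * enorm (t1 - t2))
  (margin_smooth : forall s : X * (Y * Y),
    C2_on Theta (fun t => margin beta piref (pi t) s))
  (* clean data *)
  (pD : probability (X * (Y * Y))%type R)
  (loss_integrable_pD : forall t, Theta t ->
    pD.-integrable setT (fun s => (cdpo_loss c beta piref pi s t)%:E))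
  (tstar : 'rV[R]_d)
  (tstar_argmin : is_argmin Theta (risk pD (cdpo_loss c beta piref pi)) tstar)
  (hessian_posdef :
    {ae pD, forall s, posdefmx (hessian (cdpo_loss c beta piref pi s) tstar)})
  (* flipped data: at stage i of the limiting regime F, points drawn from q i
     have their labels flipped *)
  (I : Type) (F : set_system I) (F_proper : ProperFilter F)
  (q : I -> probability (X * (Y * Y))%type R)
  (loss_integrable_pflip : forall i t, Theta t ->
    (flip_law (q i)).-integrable setT (fun s => (cdpo_loss c beta piref pi s t)%:E))
  (th : I -> R -> 'rV[R]_d)
  (th0 : forall i, th i 0 = tstar)
  (th_argmin : forall i eps, 0 <= eps -> eps < 2^-1 ->
    is_argmin Theta
      (risk (contaminated pD (flip_law (q i)) eps) (cdpo_loss c beta piref pi))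
      (th i eps))
  (th_influence : forall i, has_influence (th i))
  (* the worst-case regime, uniformly over the flipped data *)
  (reward_lose_pinfty : forall M : R, \forall i \near F,
    {ae flip_law (q i), forall s,
      M <= implicit_reward beta piref (pi tstar) s.1 s.2.2})
  (margin_ninfty : forall M : R, \forall i \near F,
    {ae flip_law (q i), forall s, margin beta piref (pi tstar) s <= M})
  (* the mean margin gradient on the flipped data does not itself vanish *)
  (flip_nonvanishing :
    ~ (enorm (vexpectation (flip_law (q i))
         (fun s => grad (fun t => margin beta piref (pi t) s) tstar))
       @[i --> F] --> (0 : R))) :
  ~ (enorm (influence (th i)) @[i --> F] --> (0 : R)).

Proof.
(* By contraposition: a vanishing influence is shown to force the mean margin gradient on the
   flipped data to vanish. *)
move=> IF0; apply: flip_nonvanishing.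
pose m (s : X * (Y * Y)) (t : 'rV[R]_d) := margin beta piref (pi t) s.
have [Tstar _] := tstar_argmin.
have /nbhs_normP[r /= r_gt0 rT'] : nbhs tstar Theta by exact: open_nbhs_nbhs.
have rT (t : 'rV[R]_d) : `|t - tstar| < r -> Theta t.
  by move=> tr; apply: rT'; rewrite /ball_/= distrC.
pose B := 2 * beta * C; pose Lam := 2 * beta * L * d%:R.
have B_ge0 : 0 <= B by rewrite !mulr_ge0// ltW.
have Lam_ge0 : 0 <= Lam by rewrite !mulr_ge0// ltW.
have m_diff s (t : 'rV[R]_d) : `|t - tstar| < r -> differentiable (m s) t.
  by move=> /rT Tt; have [] := margin_smooth s _ Tt.
have m_bound s (t : 'rV[R]_d) (j : 'I_d) : `|t - tstar| < r ->
    `|'D_(delta_mx 0 j) (m s) t| <= B.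
  move=> /rT Tt; exact: (margin_partial_bound Theta beta C piref pi Theta_open
    beta_gt0 piref_policy pi_policy logpi_diff logpi_bounded s t j Tt).
have m_lip s (t1 t2 : 'rV[R]_d) (j : 'I_d) :
    `|t1 - tstar| < r -> `|t2 - tstar| < r ->
    `|'D_(delta_mx 0 j) (m s) t1 - 'D_(delta_mx 0 j) (m s) t2|
      <= Lam * `|t1 - t2|.
  move=> /rT T1 /rT T2; exact: (margin_partial_lipschitz Theta beta L piref pi
    Theta_open beta_gt0 (ltW L_gt0) piref_policy pi_policy logpi_diff
    logpi_lipschitz s t1 t2 j T1 T2).
have m_meas (t : 'rV[R]_d) : `|t - tstar| < r -> measurable_fun setT (m ^~ t).
  by move=> /rT Tt; exact: (measurable_margin Theta beta piref pi piref_policy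
    pi_policy t Tt).
pose K := d%:R * B * B + Lam.
have K_ge0 : 0 <= K.
  by apply: addr_ge0 => //; apply: mulr_ge0 => //; exact: mulr_ge0.
(* The constant [K] does not depend on the stage [i], so the bound passes to the limit along [F]. *)
have key i j : `|mean_partial c m (flip_law (q i)) j tstar|
    <= K * enorm (influence (th i)).
  apply: (@le_trans _ _ (K * `|influence (th i)|)); last first.
    by apply: ler_wpM2l => //; exact: norm_le_enorm.
  apply: (mean_partial_le_influence c B Lam r tstar m c_ge0 c_lt1 B_ge0 Lam_ge0
    r_gt0 m_diff m_bound m_lip m_meas pD _ j _ (th_influence i) (th0 i)).
  move=> eps e0 eh er.
  have [_ emin] := th_argmin i eps e0 eh.
  have e1 : eps <= 1 by lra.
  exact: (contaminated_stationary c B Lam r tstar m c_ge0 c_lt1 B_ge0 Lam_ge0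
    m_diff m_bound m_lip m_meas pD (flip_law (q i)) eps j (th i eps)
    (fun t tr => loss_integrable_pD t (rT t tr))
    (fun t tr => loss_integrable_pflip i t (rT t tr)) e0 e1 er
    (fun t tr => emin t (rT t tr))).
pose w i j : R := \int[flip_law (q i)]_s 'D_(delta_mx 0 j) (m s) tstar.
have w0 j : `|w i j| @[i --> F] --> (0 : R).
  apply/cvgrPdist_le => /= e e0.
  (* Two errors of size [e'], from the influence bound and from saturation, add up to [(1 - c) * e];
     dividing by [1 - c > 0] leaves [e]. *)
  pose e' := e * (1 - c) / 2.
  have e'0 : 0 < e' by rewrite divr_gt0 ?mulr_gt0// subr_gt0.
  have [M MB] : exists M, expR M * B <= e'.
    (* This gives [expR M * B = e' * B / (B + 1) <= e']; adding 1 keeps the denominator positive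
       knowing only [0 <= B]. *)
    exists (ln (e' / (B + 1))); rewrite lnK ?posrE; last first.
      by rewrite divr_gt0//; lra.
    by rewrite mulrAC ler_pdivrMr; nra.
  have IFe : \forall i \near F, K * enorm (influence (th i)) <= e'.
    have : K * enorm (influence (th i)) @[i --> F] --> K * 0.
      by apply: cvgM IF0; exact: cvg_cst.
    by rewrite mulr0 => /cvgr_le; apply.
  near=> i.
  have Mi : {ae flip_law (q i), forall s, m s tstar <= M} by near: i.
  have Ki : K * enorm (influence (th i)) <= e' by near: i.
  have := mean_partial_saturates c B r tstar m c_ge0 c_lt1 B_ge0 r_gt0
    m_diff m_bound m_meas _ j M Mi.
  have := key i j; rewrite -/(w i j) sub0r normrN normr_id.
  set a := mean_partial _ _ _ _ _; move=> H1 H2.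
  (* The mean margin gradient is isolated as the saturated sum minus the mean loss gradient [a]. *)
  have H3 := ler_normB (a + (1 - c) * w i j) a.
  rewrite addrAC subrr add0r normrM gtr0_norm ?subr_gt0// in H3.
  have c1 : 0 < 1 - c by rewrite subr_gt0.
  rewrite -(ler_pM2l c1).
  have -> : (1 - c) * e = e' + e' by rewrite /e'; lra.
  lra.
have sw0 : \sum_(j < d) `|w i j| @[i --> F] --> (0 : R).
  have : \sum_(j < d) `|w i j| @[i --> F] --> \sum_(j < d) (0 : R).
    by apply: cvg_big => [|j _]; [exact: add_continuous|exact: w0].
  by rewrite big1.
(* The Euclidean norm is squeezed between 0 and the sum of the absolute coordinates. *)
apply: (squeeze_cvgr _ (cvg_cst 0) sw0).
apply: nearW => i; rewrite enorm_ge0/= (le_trans (enorm_le_sum _))//.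
apply: ler_sum => j _; rewrite !mxE le_eqVlt; apply/orP; left; apply/eqP.
congr `|_|; apply: eq_Rintegral => s _; by rewrite mxE.
Unshelve. all: by end_near. Qed.
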